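(* Let $W=(W_t:t\in T)$ be a zero-mean Gaussian process indexed by a set $T$ with covariance function $K(s,t)=\mathrm{E}W_sW_t$. Suppose that there are positive numbers $\lambda_1,\lambda_2,\ldots$ and functions $\phi_j:T\to\mathbb{R}$ such that $$K(s,t)=\sum_{j=1}^\infty\lambda_j\phi_j(s)\phi_j(t)\quad\text{for all }s,t\in T,$$ where the series converges pointwise on $T\times T$ (in particular $\sum_{j=1}^\infty\lambda_j\phi_j^2(t)<\infty$ for every $t\in T$). Suppose also that the functions $\phi_j$ are linearly independent in the following sense: if $(w_j)$ is a sequence of real numbers with $\sum_jw_j^2/\lambda_j<\infty$ and $\sum_jw_j\phi_j(t)=0$ for every $t\in T$, then $w_j=0$ for every $j$. Then the RKHS $\mathbb{H}$ of the stochastic process $W$ is the set of all functions $t\mapsto\sum_{j=1}^\infty w_j\phi_j(t)$ with $\sum_{j=1}^\infty w_j^2/\lambda_j<\infty$, and its inner product is given by $$\Big\langle\sum_{i=1}^\infty v_i\phi_i,\sum_{j=1}^\infty w_j\phi_j\Big\rangle_{\mathbb{H}}=\sum_{j=1}^\infty\frac{v_jw_j}{\lambda_j}.$$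
   Context: The RKHS (reproducing kernel Hilbert space) of a zero-mean Gaussian process $W=(W_t:t\in T)$ with covariance function $K$ is the completion $\mathbb{H}$ of the linear span of the functions $K(s,\cdot)$, $s\in T$, under the inner product $\langle\sum_i\alpha_iK(s_i,\cdot),\sum_j\beta_jK(t_j,\cdot)\rangle_{\mathbb{H}}=\sum_i\sum_j\alpha_i\beta_jK(s_i,t_j)$ (finite sums). It is identified with a space of functions on $T$ through the reproducing formula $f(t)=\langle f,K(t,\cdot)\rangle_{\mathbb{H}}$. For any sequence with $\sum_jw_j^2/\lambda_j<\infty$ the series $\sum_jw_j\phi_j(t)$ converges absolutely for every $t\in T$, by the Cauchy–Schwarz inequality. *)

(* Defs.v *)
From HB Require Import structures.
From mathcomp Require Import all_boot all_order all_algebra.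
From mathcomp Require Import all_classical all_reals all_analysis.
Set Implicit Arguments.
Unset Strict Implicit.
Unset Printing Implicit Defensive.
Import Order.TTheory GRing.Theory Num.Theory.
Import numFieldNormedType.Exports.
Local Open Scope classical_set_scope.
Local Open Scope ring_scope.

(* Point masses are the degenerate normal laws; they are listed separately
   because [normal_prob m 0] is not the point mass at [m] in the library. *)
Definition normally_distributed (R : realType) (d : measure_display)
    (Omega : measurableType d) (P : probability Omega R) (X : Omega -> R) : Prop :=
  (exists m : R, forall A : set R, measurable A -> P (X @^-1` A) = \d_m A) \/
  (exists m sigma : R, 0 < sigma /\
     forall A : set R, measurable A -> P (X @^-1` A) = normal_prob m sigma A).

(* The finite-dimensional laws are (possibly degenerate) multivariate normal:
   every finite linear combination of the coordinates is normal. *)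
Definition gaussian_process (R : realType) (d : measure_display)
    (Omega : measurableType d) (P : probability Omega R) (T : Type)
    (W : T -> {RV P >-> R}) : Prop :=
  forall a : seq (R * T),
    normally_distributed P (fun omega => \sum_(p <- a) p.1 * W p.2 omega).

Section Rkhs.
Variables (R : realType) (T : Type).
Implicit Types (K : T -> T -> R) (H : set (T -> R)).
Implicit Types (ip : (T -> R) -> (T -> R) -> R) (f g h : T -> R).

(* The list [:: (c_1, s_1); ...; (c_n, s_n)] codes sum_i c_i K(s_i, .). *)
Definition kernel_comb K (a : seq (R * T)) : T -> R :=
  fun t => \sum_(p <- a) p.1 * K p.2 t.

(* Only the values of [ip] on [H] are meaningful. *)
Record inner_product_space H ip : Prop := {
  ips_zero : H 0;
  ips_linear : forall (c : R) f g, H f -> H g -> H (c *: f + g);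
  ips_ip_linear : forall (c : R) f g h, H f -> H g -> H h ->
    ip (c *: f + g) h = c * ip f h + ip g h;
  ips_ip_sym : forall f g, H f -> H g -> ip f g = ip g f;
  ips_ip_ge0 : forall f, H f -> 0 <= ip f f;
  ips_ip_def : forall f, H f -> ip f f = 0 -> f = 0 }.

Definition ip_norm ip f : R := Num.sqrt (ip f f).

Definition ip_complete H ip : Prop :=
  forall u : nat -> T -> R, (forall n, H (u n)) ->
    (forall e : R, 0 < e -> exists N : nat, forall m n : nat,
       (N <= m)%N -> (N <= n)%N -> ip_norm ip (u m - u n) < e) ->
    exists2 f, H f & (fun n => ip_norm ip (u n - f)) @ \oo --> (0 : R).

(* [(H, ip)] is the completion of the span of the functions K(s, .) under the
   inner product prescribed on kernel combinations, realized as a space of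
   functions on [T] by the reproducing formula. *)
Record is_rkhs K H ip : Prop := {
  rkhs_ips : inner_product_space H ip;
  rkhs_span : forall a, H (kernel_comb K a);
  rkhs_span_ip : forall a b, ip (kernel_comb K a) (kernel_comb K b) =
    \sum_(p <- a) \sum_(q <- b) p.1 * q.1 * K p.2 q.2;
  rkhs_dense : forall f (e : R), H f -> 0 < e ->
    exists a, ip_norm ip (f - kernel_comb K a) < e;
  rkhs_complete : ip_complete H ip;
  rkhs_reproducing : forall f t, H f -> f t = ip f (K t) }.

End Rkhs.

(* Sequences are indexed from 0 instead of 1. *)
Definition weighted_summable (R : realType) (lambda w : nat -> R) : Prop :=
  cvgn (series (fun j => w j ^+ 2 / lambda j)).

Definition series_fun (R : realType) (T : Type) (phi : nat -> T -> R)
    (w : nat -> R) : T -> R :=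
  fun t => limn (series (fun j => w j * phi j t)).

(* Main.v *)
(* Since [K s] is the series with coefficients [lambda j * phi j s], pairing
   [sum_j w_j phi_j] with [K s] in the weighted l2 product gives back its value
   at [s].  Hence in the candidate space only 0 is orthogonal to all [K s], and
   the orthogonal projection onto the closed span makes the kernel combinations
   dense.  Conversely, an RKHS is unique: a norm limit of kernel combinations is
   also a pointwise limit, and their norms are prescribed.  Linear independence
   of the [phi_j] is what makes the candidate inner product well defined. *)
Require Import Defs.
From HB Require Import structures.
From mathcomp Require Import all_boot all_order all_algebra.
From mathcomp Require Import ring lra.
From mathcomp Require Import all_classical all_reals all_analysis.
Set Implicit Arguments.
Unset Strict Implicit.
Unset Printing Implicit Defensive.
Import Order.TTheory GRing.Theory Num.Theory.
Import numFieldNormedType.Exports.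
Local Open Scope classical_set_scope.
Local Open Scope ring_scope.


(** * Geometry of inner product spaces of functions *)

Section InnerProductSpace.
Context {R : realType} {T : Type}.
Context {H : set (T -> R)} {ip : (T -> R) -> (T -> R) -> R}.
Context (HI : inner_product_space H ip).
Implicit Types (f g h : T -> R) (u : nat -> T -> R) (c : R).

Lemma ips_scale c f : H f -> H (c *: f).
Proof. by move=> Hf; rewrite -[_ *: _]addr0; apply: (ips_linear HI) => //; exact: ips_zero HI. Qed.

Lemma ips_add f g : H f -> H g -> H (f + g).
Proof. by move=> Hf Hg; rewrite -[f]scale1r; exact: (ips_linear HI). Qed.

Lemma ips_sub f g : H f -> H g -> H (f - g).
Proof. by move=> Hf Hg; rewrite addrC -scaleN1r; exact: (ips_linear HI). Qed.

Lemma ipDl f g h : H f -> H g -> H h -> ip (f + g) h = ip f h + ip g h.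
Proof.
by move=> Hf Hg Hh; rewrite -[f in LHS]scale1r (ips_ip_linear HI)// mul1r.
Qed.

Lemma ip0l h : H h -> ip 0 h = 0.
Proof.
move=> Hh; have H0 := ips_zero HI.
by apply: (@addrI _ (ip 0 h)); rewrite -ipDl// !addr0.
Qed.

Lemma ipZl c f h : H f -> H h -> ip (c *: f) h = c * ip f h.
Proof.
move=> Hf Hh; have H0 := ips_zero HI.
by rewrite -[c *: f]addr0 (ips_ip_linear HI)// ip0l// addr0.
Qed.

Lemma ipBl f g h : H f -> H g -> H h -> ip (f - g) h = ip f h - ip g h.
Proof.
move=> Hf Hg Hh; rewrite addrC -scaleN1r (ips_ip_linear HI)//.
by rewrite mulN1r addrC.
Qed.

Lemma ip_sqD c f g : H f -> H g ->
  ip (c *: f + g) (c *: f + g) = c ^+ 2 * ip f f + 2 * c * ip f g + ip g g.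
Proof.
move=> Hf Hg; have Hfg := ips_linear HI c Hf Hg.
rewrite (ips_ip_linear HI)// [ip f (_ + _)](ips_ip_sym HI)//.
rewrite [ip g (_ + _)](ips_ip_sym HI)// !(ips_ip_linear HI)//.
by rewrite [ip g f](ips_ip_sym HI)//; ring.
Qed.

Lemma ip_sqB f g : H f -> H g ->
  ip (f - g) (f - g) = ip f f - 2 * ip f g + ip g g.
Proof.
move=> Hf Hg; rewrite addrC -scaleN1r ip_sqD//.
by rewrite [ip g f](ips_ip_sym HI)//; ring.
Qed.

(** If [ip f f] is 0, definiteness gives [f = 0]. Otherwise the squared norm of [c *: f + g] is
    nonnegative at its minimiser c = - <f,g> / <f,f>, and multiplying by <f,f> gives the bound. *)
Lemma ip_cauchy_schwarz f g : H f -> H g -> ip f g ^+ 2 <= ip f f * ip g g.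
Proof.
move=> Hf Hg; have [f0|fN0] := eqVneq (ip f f) 0.
  by rewrite f0 mul0r (ips_ip_def HI Hf f0) ip0l// expr0n.
have ff_gt0 : 0 < ip f f by rewrite lt_neqAle eq_sym fN0 (ips_ip_ge0 HI).
have := ips_ip_ge0 HI (ips_linear HI (- (ip f g / ip f f)) Hf Hg).
rewrite ip_sqD// -(pmulr_rge0 _ ff_gt0) => /le_trans h.
rewrite -subr_ge0; apply: h; rewrite le_eqVlt; apply/orP; left; apply/eqP.
by field.
Qed.

Lemma ip_norm_ge0 f : 0 <= ip_norm ip f.
Proof. exact: sqrtr_ge0. Qed.

Lemma sqr_ip_norm f : H f -> ip_norm ip f ^+ 2 = ip f f.
Proof. by move=> Hf; rewrite sqr_sqrtr// (ips_ip_ge0 HI). Qed.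

Lemma ip_norm_cauchy_schwarz f g : H f -> H g ->
  `|ip f g| <= ip_norm ip f * ip_norm ip g.
Proof.
move=> Hf Hg; rewrite -ler_sqr ?nnegrE ?mulr_ge0 ?ip_norm_ge0//.
by rewrite real_normK ?num_real// exprMn !sqr_ip_norm// ip_cauchy_schwarz.
Qed.

Lemma ip_norm_triangle f g : H f -> H g ->
  ip_norm ip (f + g) <= ip_norm ip f + ip_norm ip g.
Proof.
move=> Hf Hg; have Hfg := ips_add Hf Hg.
rewrite -ler_sqr ?nnegrE ?addr_ge0 ?ip_norm_ge0//.
rewrite sqr_ip_norm// -[f in leLHS]scale1r ip_sqD// sqrrD !sqr_ip_norm//.
have := le_trans (ler_norm _) (ip_norm_cauchy_schwarz Hf Hg).
by rewrite expr1n !mul1r mulr1 -mulr_natl; lra.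
Qed.

Lemma ip_norm_subC f g : H f -> H g -> ip_norm ip (f - g) = ip_norm ip (g - f).
Proof.
move=> Hf Hg; rewrite /ip_norm !ip_sqB// [ip g f](ips_ip_sym HI)//.
by congr Num.sqrt; ring.
Qed.

Lemma ip_norm_dist f g h : H f -> H g -> H h ->
  ip_norm ip (f - g) <= ip_norm ip (f - h) + ip_norm ip (g - h).
Proof.
move=> Hf Hg Hh; rewrite (ip_norm_subC Hg Hh).
have -> : f - g = (f - h) + (h - g) by rewrite addrA subrK.
by apply: ip_norm_triangle; exact: ips_sub.
Qed.

Lemma ip_norm_lip f g : H f -> H g ->
  `|ip_norm ip f - ip_norm ip g| <= ip_norm ip (f - g).
Proof.
move=> Hf Hg.
have := ip_norm_triangle (ips_sub Hf Hg) Hg; rewrite subrK.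
have := ip_norm_triangle (ips_sub Hg Hf) Hf; rewrite subrK (ip_norm_subC Hg)//.
by move=> h1 h2; rewrite ler_norml; apply/andP; split; lra.
Qed.

(** Cauchy-Schwarz applied to [u n - f] and [g]. With [g := K t] and the reproducing formula, this
    turns norm limits into pointwise limits. *)
Lemma ip_cvg u f g : (forall n, H (u n)) -> H f -> H g ->
  (fun n => ip_norm ip (u n - f)) @ \oo --> (0 : R) ->
  (fun n => ip (u n) g) @ \oo --> ip f g.
Proof.
move=> Hu Hf Hg uf; apply/subr_cvg0.
have k0 : (fun n => ip_norm ip (u n - f) * ip_norm ip g) @ \oo --> (0 : R).
  by rewrite -[X in _ --> X](mul0r (ip_norm ip g)); apply: cvgM => //; exact: cvg_cst.
apply/norm_cvg0P; apply: (squeeze_cvgr _ (cvg_cst 0) k0).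
apply: nearW => n; rewrite normr_ge0/= -ipBl//.
by apply: ip_norm_cauchy_schwarz => //; exact: ips_sub.
Qed.

Lemma ip_norm_cvg u f : (forall n, H (u n)) -> H f ->
  (fun n => ip_norm ip (u n - f)) @ \oo --> (0 : R) ->
  (fun n => ip_norm ip (u n)) @ \oo --> ip_norm ip f.
Proof.
move=> Hu Hf uf; apply/subr_cvg0.
apply/norm_cvg0P; apply: (squeeze_cvgr _ (cvg_cst 0) uf).
by apply: nearW => n; rewrite normr_ge0/= ip_norm_lip.
Qed.

Lemma ip_cvg_cauchy u f : (forall n, H (u n)) -> H f ->
  (fun n => ip_norm ip (u n - f)) @ \oo --> (0 : R) ->
  forall e : R, 0 < e -> exists N : nat, forall m n : nat,
    (N <= m)%N -> (N <= n)%N -> ip_norm ip (u m - u n) < e.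
Proof.
move=> Hu Hf /cvgr0Pnorm_lt uf e e0.
have [N _ HN] := uf _ (divr_gt0 e0 (@ltr0n R 2)).
exists N => m n Nm Nn; apply: (le_lt_trans (ip_norm_dist (Hu m) (Hu n) Hf)).
have := HN m Nm; have := HN n Nn; rewrite /= !ger0_norm ?ip_norm_ge0//.
by move=> h1 h2; lra.
Qed.

(** Membership and value go through one induction, since linearity of [ip] at the head needs the
    tail to lie in [H]. *)
Lemma ip_kernel_comb (K : T -> T -> R) (a : seq (R * T)) g :
  (forall s, H (K s)) -> H g ->
  H (kernel_comb K a) /\
  ip (kernel_comb K a) g = \sum_(p <- a) p.1 * ip (K p.2) g.
Proof.
move=> HK Hg; elim: a => [|p a [Ha IH]].
  rewrite big_nil; have -> : kernel_comb K [::] = 0.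
    by apply/funext => t; rewrite /kernel_comb big_nil.
  by split; [exact: ips_zero HI | exact: ip0l].
have -> : kernel_comb K (p :: a) = p.1 *: K p.2 + kernel_comb K a.
  by apply/funext => t; rewrite /kernel_comb big_cons.
by rewrite big_cons (ips_ip_linear HI)// IH; split=> //; exact: ips_linear HI _ _ _ _ _.
Qed.

(** Projection argument: a sequence in [M] minimising the distance to [f] is Cauchy, and its limit
    [z] makes [f - z] orthogonal to [M], so [f = z]. The subspace [M] need not be closed, so [z] is
    only known to lie in [H]. *)
Lemma dense_of_orthogonal (M : set (T -> R)) : ip_complete H ip ->
  (forall m, M m -> H m) -> M 0 ->
  (forall c f g, M f -> M g -> M (c *: f + g)) ->
  (forall f, H f -> (forall m, M m -> ip f m = 0) -> f = 0) ->
  forall f (e : R), H f -> 0 < e -> exists2 m, M m & ip_norm ip (f - m) < e.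
Proof.
move=> Hc MH M0 Mlin Mperp f e Hf e0.
pose D := [set ip (f - m) (f - m) | m in M].
have Dlb : has_lbound D.
  by exists 0 => _ [m Mm <-]; apply: (ips_ip_ge0 HI); apply: ips_sub => //; exact: MH.
have Dinf : has_inf D by split=> //; exists (ip (f - 0) (f - 0)); exists 0.
have Dle m : M m -> inf D <= ip (f - m) (f - m).
  by move=> Mm; apply: ge_inf => //; exists m.
have /choice[u uP] n :
    exists m, M m /\ ip (f - m) (f - m) < inf D + harmonic n.
  have h0 : 0 < harmonic n :> R by rewrite /harmonic/= invr_gt0.
  have [_ [m Mm <-] hm] := inf_adherent h0 Dinf.
  by exists m.
have Mu n : M (u n) by case: (uP n).
have Hu n : H (u n) by apply: MH.
have uD n : ip (f - u n) (f - u n) < inf D + harmonic n by case: (uP n).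
have Hfu n : H (f - u n) by exact: ips_sub.
(* Parallelogram law: the midpoint of [u a] and [u b] is at distance at least
   [inf D] from [f]. *)
have uab a b : ip (u a - u b) (u a - u b) <= 2 * (harmonic a + harmonic b).
  (* The trailing 0 lets the midpoint be built by two uses of [Mlin], starting from [M0]. *)
  pose m := 2^-1 *: u a + (2^-1 *: u b + 0).
  have Mm : M m by apply: (Mlin _ _ _) => //; apply: (Mlin _ _ _).
  have := Dle _ Mm.
  have -> : f - m = 2^-1 *: (f - u a) + 2^-1 *: (f - u b).
    apply/funext => t; rewrite /m.
    change (f t - (2^-1 * u a t + (2^-1 * u b t + 0)) =
      2^-1 * (f t - u a t) + 2^-1 * (f t - u b t)).
    by field.
  have -> : u a - u b = (f - u b) - (f - u a).
    by rewrite opprB [RHS]addrC addrA subrK.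
  have Hb := ips_scale 2^-1 (Hfu b).
  rewrite ip_sqB// ip_sqD// ipZl// [ip _ (2^-1 *: _)](ips_ip_sym HI)// ipZl//.
  rewrite [ip _ (2^-1 *: _)](ips_ip_sym HI)// ipZl//.
  have := uD a; have := uD b.
  by move=> h1 h2; rewrite expr2; lra.
have [eps eps0|z Hz uz] := Hc u Hu.
  (* [uab] doubles a sum of two harmonic terms, hence the quarter. *)
  have /cvgr0Pnorm_lt/(_ (eps ^+ 2 / 4)) := @cvg_harmonic R.
  have e4 : 0 < eps ^+ 2 / 4 by rewrite divr_gt0// exprn_gt0.
  move=> /(_ e4)[N _ HN]; exists N => a b Na Nb.
  rewrite -ltr_sqr ?nnegrE ?ip_norm_ge0 ?(ltW eps0)//.
  rewrite sqr_ip_norm; last exact: ips_sub.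
  apply: (le_lt_trans (uab a b)).
  have := le_lt_trans (ler_norm _) (HN a Na).
  have := le_lt_trans (ler_norm _) (HN b Nb).
  by move=> h1 h2; lra.
have Hfz : H (f - z) by exact: ips_sub.
suff fz : f = z.
  have /cvgr0Pnorm_lt/(_ _ e0)[N _ /(_ N (leqnn N))] := uz.
  rewrite /= ger0_norm ?ip_norm_ge0// -fz => ue.
  by exists (u N) => //; rewrite ip_norm_subC.
apply/eqP; rewrite -subr_eq0; apply/eqP; apply: Mperp => // m Mm.
have Hm := MH _ Mm.
have lim : (fun n => ip (f - u n) m) @ \oo --> ip (f - z) m.
  under eq_fun do rewrite ipBl//.
  by rewrite ipBl//; apply: cvgB; [exact: cvg_cst | exact: ip_cvg].
set L := ip (f - z) m in lim *.
(* The perturbation [c *: m + u n] stays in [M], so its squared distance to [f] is at least [inf D],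
   while that of [u n] is below [inf D + harmonic n]. Expand and let n tend to infinity. *)
have quad c : 2 * c * L <= c ^+ 2 * ip m m.
  have l1 : (fun n => 2 * c * ip (f - u n) m) @ \oo --> 2 * c * L.
    by apply: cvgM => //; exact: cvg_cst.
  have l2 : (fun n => c ^+ 2 * ip m m + harmonic n) @ \oo --> c ^+ 2 * ip m m.
    rewrite -[X in _ --> X]addr0; apply: cvgD; first exact: cvg_cst.
    exact: cvg_harmonic.
  apply: (ler_cvg_to l1 l2); apply: nearW => n.
  have := Dle _ (Mlin c _ _ Mm (Mu n)).
  have -> : f - (c *: m + u n) = (- c) *: m + (f - u n).
    by rewrite scaleNr opprD addrCA.
  rewrite ip_sqD// [ip m (_ - _)](ips_ip_sym HI)// sqrrN.
  by have := uD n; lra.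
have q0 := ips_ip_ge0 HI Hm.
(* The added 1 keeps the divisor nonzero when [m] is 0. *)
have q1 : ip m m + 1 != 0 by rewrite gt_eqF// ltr_wpDl.
(* If [c (|m|^2 + 1) = L], then [quad c] says [c^2 (|m|^2 + 2) <= 0]. *)
pose c := L / (ip m m + 1).
have Lc : L = c * (ip m m + 1) by rewrite /c divfK.
have := quad c; rewrite Lc => qc.
have c2 : c ^+ 2 * (ip m m + 2) <= 0 by lra.
have : c ^+ 2 <= 0 by rewrite -(pmulr_lle0 _ (ltr_wpDl q0 (@ltr0n R 2))).
by rewrite exprn_even_le0//= => /eqP ->; rewrite mul0r.
Qed.

End InnerProductSpace.

(** * Uniqueness of the RKHS of a kernel *)

Section RkhsUniqueness.
Context {R : realType} {T : Type} {K : T -> T -> R}.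
Implicit Types (H : set (T -> R)) (ip : (T -> R) -> (T -> R) -> R).

(** Distances between kernel combinations are thereby norms of kernel combinations, which [K] alone
    determines. *)
Lemma kernel_combB (a b : seq (R * T)) : kernel_comb K a - kernel_comb K b =
  kernel_comb K (a ++ [seq (- p.1, p.2) | p <- b]).
Proof.
apply/funext => t; rewrite /kernel_comb big_cat big_map /=.
under [X in _ = _ + X]eq_bigr do rewrite mulNr.
by rewrite sumrN.
Qed.

Lemma kernel_comb1 s : kernel_comb K [:: (1, s)] = K s.
Proof. by apply/funext => t; rewrite /kernel_comb big_seq1 mul1r. Qed.

(** Kernel combinations converging to [f] in [H] are Cauchy in [H'] as well. Their limit there has
    the same values as [f], and the equal norms along the sequence pass to the limit. *)
Lemma rkhs_norm_sub H ip H' ip' : is_rkhs K H ip -> is_rkhs K H' ip' ->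
  forall f, H f -> H' f /\ ip f f = ip' f f.
Proof.
move=> HK HK' f Hf.
have HI := rkhs_ips HK; have HI' := rkhs_ips HK'.
have /choice[a aP] n : exists a, ip_norm ip (f - kernel_comb K a) < harmonic n.
  by apply: (rkhs_dense HK Hf); rewrite /harmonic/= invr_gt0.
pose u n := kernel_comb K (a n).
have Hu n : H (u n) by exact: rkhs_span HK _.
have Hu' n : H' (u n) by exact: rkhs_span HK' _.
have uf : (fun n => ip_norm ip (u n - f)) @ \oo --> (0 : R).
  apply: (squeeze_cvgr _ (cvg_cst 0) cvg_harmonic).
  apply: nearW => n; rewrite ip_norm_ge0/= (ip_norm_subC HI)//.
  exact: ltW (aP n).
have nE b : ip_norm ip' (kernel_comb K b) = ip_norm ip (kernel_comb K b).
  by rewrite /ip_norm (rkhs_span_ip HK) (rkhs_span_ip HK').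
have [e e0|f' Hf' uf'] := rkhs_complete HK' Hu'.
  have [N HN] := ip_cvg_cauchy HI Hu Hf uf e0.
  exists N => m n Nm Nn; rewrite /u kernel_combB nE -kernel_combB.
  exact: HN.
have ff' : f = f'.
  apply/funext => t.
  have Kt : H (K t) by rewrite -kernel_comb1; exact: rkhs_span HK _.
  have Kt' : H' (K t) by rewrite -kernel_comb1; exact: rkhs_span HK' _.
  rewrite (rkhs_reproducing HK t Hf) (rkhs_reproducing HK' t Hf').
  have l1 := ip_cvg HI Hu Hf Kt uf; have l2 := ip_cvg HI' Hu' Hf' Kt' uf'.
  apply: (cvg_unique _ l1); first exact: Rhausdorff.
  (* Both pairings are the value [u n t], by the two reproducing formulas. *)
  have -> // : (fun n => ip (u n) (K t)) = (fun n => ip' (u n) (K t)).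
  apply/funext => n.
  by rewrite -(rkhs_reproducing HK)// -(rkhs_reproducing HK').
rewrite -ff' in Hf' uf'; split=> //.
have l1 := ip_norm_cvg HI Hu Hf uf; have l2 := ip_norm_cvg HI' Hu' Hf' uf'.
rewrite -(sqr_ip_norm HI)// -(sqr_ip_norm HI')//; congr (_ ^+ 2).
apply: (cvg_unique _ l1); first exact: Rhausdorff.
have -> // : (fun n => ip_norm ip (u n)) = (fun n => ip_norm ip' (u n)).
by apply/funext => n; rewrite nE.
Qed.

(** Polarization: the squared norms of [f], [g] and [f - g] determine [ip f g]. *)
Lemma rkhs_unique H ip H' ip' : is_rkhs K H ip -> is_rkhs K H' ip' ->
  H = H' /\ forall f g, H f -> H g -> ip f g = ip' f g.
Proof.
move=> HK HK'; split.
  by apply/seteqP; split => f Hf;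
    [case: (rkhs_norm_sub HK HK' Hf) | case: (rkhs_norm_sub HK' HK Hf)].
move=> f g Hf Hg.
have HI := rkhs_ips HK; have HI' := rkhs_ips HK'.
have [Hf' ff] := rkhs_norm_sub HK HK' Hf.
have [Hg' gg] := rkhs_norm_sub HK HK' Hg.
have [_] := rkhs_norm_sub HK HK' (ips_sub HI Hf Hg).
by rewrite (ip_sqB HI)// (ip_sqB HI')//; lra.
Qed.

End RkhsUniqueness.

(** * Weighted square-summable sequences and their function series *)

Section SeriesExpansion.
Context {R : realType} {T : Type} {K : T -> T -> R}.
Context {lambda : nat -> R} {phi : nat -> T -> R}.
Context (lambda_gt0 : forall j : nat, 0 < lambda j).
Context (K_series : forall s t : T,
  series (fun j => lambda j * phi j s * phi j t) @ \oo --> K s t).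
Implicit Types (v w : nat -> R) (c : R).

Let lambda_neq0 j : lambda j != 0. Proof. by rewrite gt_eqF. Qed.

Let weighted_sq_ge0 w j : 0 <= w j ^+ 2 / lambda j.
Proof. by rewrite divr_ge0 ?sqr_ge0// ltW. Qed.

Lemma cvg_series_linear (a b : nat -> R) c (la lb : R) :
  series a @ \oo --> la -> series b @ \oo --> lb ->
  series (fun j => c * a j + b j) @ \oo --> c * la + lb.
Proof.
move=> ala blb.
have -> : series (fun j => c * a j + b j) =
    (fun n => c * series a n + series b n).
  by apply/funext => n; rewrite /series/= mulr_sumr -big_split.
by apply: cvgD => //; apply: cvgM => //; exact: cvg_cst.
Qed.

(** Absolute convergence by comparison: |v w| is at most v^2 + w^2. *)
Lemma weighted_prod_cvg v w :
  weighted_summable lambda v -> weighted_summable lambda w ->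
  cvgn (series (fun j => v j * w j / lambda j)).
Proof.
move=> Hv Hw; apply: normed_cvg.
apply: (@series_le_cvg _ _
  (fun j => 1 * (v j ^+ 2 / lambda j) + w j ^+ 2 / lambda j)) => [j|j|j|].
- exact: normr_ge0.
- by rewrite mul1r addr_ge0.
- rewrite /= mul1r -mulrDl normrM (@ger0_norm _ (lambda j)^-1) ?invr_ge0 ?(ltW (lambda_gt0 j))//.
  apply: ler_wpM2r; first by rewrite invr_ge0 ltW.
  rewrite normrM.
  rewrite -(real_normK (num_real (v j))) -(real_normK (num_real (w j))).
  have := sqr_ge0 (`|v j| - `|w j|); have := normr_ge0 (v j).
  have := normr_ge0 (w j); move: `|v j| `|w j| => x y; nra.
- by apply/cvg_ex; eexists; apply: cvg_series_linear; [exact: Hv|exact: Hw].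
Qed.

Lemma weighted_summable_linear c v w :
  weighted_summable lambda v -> weighted_summable lambda w ->
  weighted_summable lambda (fun j => c * v j + w j).
Proof.
move=> Hv Hw; rewrite /weighted_summable.
(* The square is expanded into nested terms of the form c * a + b, the cross term being counted
   twice, to match [cvg_series_linear]. *)
have -> : (fun j => (c * v j + w j) ^+ 2 / lambda j) =
    (fun j => c * (c * (v j ^+ 2 / lambda j) + (1 * (v j * w j / lambda j) +
       v j * w j / lambda j)) + w j ^+ 2 / lambda j).
  by apply/funext => j; ring.
have Hvw := weighted_prod_cvg Hv Hw.
apply/cvg_ex; eexists; apply: cvg_series_linear; last exact: Hw.
apply: cvg_series_linear; first exact: Hv.
by apply: cvg_series_linear; exact: Hvw.
Qed.

Lemma weighted_summable0 : weighted_summable lambda (fun=> 0).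
Proof.
rewrite /weighted_summable; have -> : series (fun j => 0 ^+ 2 / lambda j) = (fun=> 0).
  by apply/funext => n; rewrite /series/= big1// => j _; rewrite expr0n mul0r.
exact: is_cvg_cst.
Qed.

Lemma series_fun0 : series_fun phi (fun=> 0) = 0.
Proof.
apply/funext => t; rewrite /series_fun.
have -> : series (fun j => 0 * phi j t) = (fun=> 0).
  by apply/funext => n; rewrite /series/= big1// => j _; rewrite mul0r.
exact: lim_cst.
Qed.

Definition kernel_coef (t : T) : nat -> R := fun j => lambda j * phi j t.

(** The weighted square sum is the diagonal value [K t t]. *)
Lemma kernel_coef_summable t : weighted_summable lambda (kernel_coef t).
Proof.
rewrite /weighted_summable; apply/cvg_ex; exists (K t t).
have -> // : (fun j => kernel_coef t j ^+ 2 / lambda j) =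
  (fun j => lambda j * phi j t * phi j t).
by apply/funext => j; rewrite /kernel_coef; have l0 := lambda_neq0 j; field.
Qed.

Lemma series_fun_kernel_coef s : series_fun phi (kernel_coef s) = K s.
Proof. by apply/funext => t; apply: cvg_lim => //; exact: K_series. Qed.

(** Evaluation at [t] is, term by term, the weighted pairing with [kernel_coef t]. Convergence of
    the function series and the reproducing formula both rest on this. *)
Lemma kernel_coefE w t : (fun j => w j * kernel_coef t j / lambda j) =
  (fun j => w j * phi j t).
Proof.
by apply/funext => j; rewrite /kernel_coef; have l0 := lambda_neq0 j; field.
Qed.

(** Ensures that the [limn] in [series_fun] is a genuine sum and not the default value of a
    divergent sequence. *)
Lemma series_fun_cvg w t : weighted_summable lambda w ->
  series (fun j => w j * phi j t) @ \oo --> series_fun phi w t.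
Proof.
move=> Hw; rewrite /series_fun -kernel_coefE.
by apply: weighted_prod_cvg => //; exact: kernel_coef_summable.
Qed.

Lemma series_fun_linear c v w :
  weighted_summable lambda v -> weighted_summable lambda w ->
  series_fun phi (fun j => c * v j + w j) =
  c *: series_fun phi v + series_fun phi w.
Proof.
move=> Hv Hw; apply/funext => t; apply: cvg_lim => //.
have -> : (fun j => (c * v j + w j) * phi j t) =
    (fun j => c * (v j * phi j t) + w j * phi j t).
  by apply/funext => j; ring.
by apply: cvg_series_linear; exact: series_fun_cvg.
Qed.

(** * The weighted sequence space as an RKHS *)

Section Weighted.
Context {H : set (T -> R)} {ip : (T -> R) -> (T -> R) -> R}.
Context (HE : H = [set f | exists2 w : nat -> R,
  weighted_summable lambda w & f = series_fun phi w]).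
Context (ipE : forall v w : nat -> R,
  weighted_summable lambda v -> weighted_summable lambda w ->
  series (fun j => v j * w j / lambda j) @ \oo -->
    ip (series_fun phi v) (series_fun phi w)).

Let ip_eq v w (x : R) :
  weighted_summable lambda v -> weighted_summable lambda w ->
  series (fun j => v j * w j / lambda j) @ \oo --> x ->
  ip (series_fun phi v) (series_fun phi w) = x.
Proof.
move=> Hv Hw; apply: cvg_unique; first exact: Rhausdorff.
exact: ipE.
Qed.

Let ip_sq_cvg w : weighted_summable lambda w ->
  series (fun j => w j ^+ 2 / lambda j) @ \oo -->
    ip (series_fun phi w) (series_fun phi w).
Proof. by move=> Hw; under eq_fun do rewrite expr2; exact: ipE. Qed.

Let nondecreasing_weighted w :
  nondecreasing_seq (series (fun j => w j ^+ 2 / lambda j)).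
Proof. by apply: nondecreasing_series => j _ _. Qed.

Lemma weighted_partial_le w n : weighted_summable lambda w ->
  series (fun j => w j ^+ 2 / lambda j) n <=
    ip (series_fun phi w) (series_fun phi w).
Proof.
move=> Hw; have <- := cvg_lim (@Rhausdorff _) (ip_sq_cvg Hw).
exact: nondecreasing_cvgn_le.
Qed.

(** The norm controls every coefficient; this yields definiteness, and Cauchy coefficients in the
    completeness proof. *)
Lemma weighted_coord_le w j : weighted_summable lambda w ->
  w j ^+ 2 / lambda j <= ip (series_fun phi w) (series_fun phi w).
Proof.
(* [series] excludes its upper index, so term j first appears in the partial sum at [j.+1]. *)
move=> Hw; apply: le_trans (weighted_partial_le j.+1 Hw).
by rewrite seriesSr lerDr/= /series/= sumr_ge0.
Qed.

(** Nondecreasing partial sums converge once bounded. Completeness uses this to obtain summability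
    of a coefficientwise limit. *)
Lemma weighted_bounded w (C : R) :
  (forall n, series (fun j => w j ^+ 2 / lambda j) n <= C) ->
  weighted_summable lambda w /\
  ip (series_fun phi w) (series_fun phi w) <= C.
Proof.
move=> HC; have Hw : weighted_summable lambda w.
  apply: nondecreasing_is_cvgn => //.
  by exists C => _ [n _ <-].
split=> //; apply: (cvgr_to_le (ip_sq_cvg Hw)).
exact: nearW.
Qed.

Lemma weighted_ips : inner_product_space H ip.
Proof.
split; rewrite ?HE.
- by exists (fun=> 0); [exact: weighted_summable0 | rewrite series_fun0].
- move=> c _ _ [v Hv ->] [w Hw ->]; exists (fun j => c * v j + w j).
    exact: weighted_summable_linear.
  by rewrite series_fun_linear.
- move=> c _ _ _ [v Hv ->] [w Hw ->] [x Hx ->]; rewrite -series_fun_linear//.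
  apply: ip_eq => //; first exact: weighted_summable_linear.
  have -> : (fun j => (c * v j + w j) * x j / lambda j) =
      (fun j => c * (v j * x j / lambda j) + w j * x j / lambda j).
    by apply/funext => j; ring.
  by apply: cvg_series_linear; exact: ipE.
- move=> _ _ [v Hv ->] [w Hw ->]; apply: ip_eq => //.
  by under eq_fun do rewrite mulrC [v _ * _]mulrC -mulrC; exact: ipE.
(* The empty partial sum, which is 0, serves as the lower bound. *)
- move=> _ [w Hw ->]; apply: le_trans (weighted_partial_le 0 Hw).
  by rewrite /series/= big_nil.
- move=> _ [w Hw ->] w0; suff -> : w = (fun=> 0) by exact: series_fun0.
  apply/funext => j; have := weighted_coord_le j Hw.
  by rewrite w0 pmulr_lle0 ?invr_gt0// exprn_even_le0//= => /eqP.
Qed.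

Lemma weighted_kernel s : H (K s).
Proof.
rewrite HE; exists (kernel_coef s); first exact: kernel_coef_summable.
by rewrite series_fun_kernel_coef.
Qed.

Lemma weighted_reproducing f t : H f -> f t = ip f (K t).
Proof.
rewrite HE => -[w Hw ->]; rewrite -series_fun_kernel_coef; apply/esym.
apply: ip_eq => //; first exact: kernel_coef_summable.
by rewrite kernel_coefE; exact: series_fun_cvg.
Qed.

(** As for l2: coefficients converge one by one, and the Cauchy bound on finite partial sums
    survives the limit uniformly in their length. *)
Lemma weighted_complete : ip_complete H ip.
Proof.
move=> u Hu uC.
have HI := weighted_ips.
have /choice[w wP] n :
    exists w, weighted_summable lambda w /\ u n = series_fun phi w.
  by have := Hu n; rewrite HE => -[w Hw ->]; exists w.
have Hw n : weighted_summable lambda (w n) by case: (wP n).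
pose d m n : nat -> R := fun j => - 1 * w n j + w m j.
have Hd m n : weighted_summable lambda (d m n).
  exact: weighted_summable_linear.
have dE m n : u m - u n = series_fun phi (d m n).
  rewrite series_fun_linear//; have [_ <-] := wP n; have [_ <-] := wP m.
  by rewrite scaleN1r addrC.
have dsq e m n : 0 < e -> ip_norm ip (u m - u n) < e ->
    ip (series_fun phi (d m n)) (series_fun phi (d m n)) <= e ^+ 2.
  move=> e0 he; rewrite -dE -(sqr_ip_norm HI); last exact: (ips_sub HI).
  by rewrite ler_sqr ?nnegrE ?ip_norm_ge0 ?(ltW e0)//; exact: ltW.
have wC j : cvgn (fun n => w n j).
  apply: cauchy_cvg; apply/cauchy_exP => e e0.
  (* A norm bound r bounds coefficient j by r sqrt(lambda_j), here e / 2. *)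
  have r0 : 0 < e / (2 * Num.sqrt (lambda j)).
    by rewrite divr_gt0// mulr_gt0// sqrtr_gt0.
  have [N HN] := uC _ r0; exists (w N j); exists N => // n /= Nn.
  have := le_trans (weighted_coord_le j (Hd N n)) (dsq _ _ _ r0 (HN _ _ (leqnn N) Nn)).
  rewrite ler_pdivrMr// exprMn exprVn exprMn sqr_sqrtr ?(ltW (lambda_gt0 j))//.
  have -> : e ^+ 2 * (2 ^+ 2 * lambda j)^-1 * lambda j = (e / 2) ^+ 2.
    by have l0 := lambda_neq0 j; field.
  rewrite -(real_normK (num_real (d _ _ _))) ler_sqr ?nnegrE ?divr_ge0 ?(ltW e0)//.
  rewrite /d mulN1r addrC => h.
  by rewrite /ball/= (le_lt_trans h)// ltr_pdivrMr// ltr_pMr// ltr1n.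
pose l j := limn (fun n => w n j).
pose r n : nat -> R := fun j => - 1 * w n j + l j.
have tail e : 0 < e -> exists N : nat, forall n, (N <= n)%N ->
    weighted_summable lambda (r n) /\
    ip (series_fun phi (r n)) (series_fun phi (r n)) <= e ^+ 2.
  move=> e0; have [N HN] := uC _ e0; exists N => n Nn.
  apply: weighted_bounded => J.
  (* With [n] and the length [J] fixed, only finitely many coefficients are involved as m tends to
     infinity. *)
  have lim : (fun m => series (fun j => d m n j ^+ 2 / lambda j) J) @ \oo -->
      series (fun j => r n j ^+ 2 / lambda j) J.
    rewrite /series/=; elim: J => [|J IH].
      by rewrite big_nil; under eq_fun do rewrite big_nil; exact: cvg_cst.
    rewrite big_nat_recr//=; under eq_fun do rewrite big_nat_recr//=.
    apply: cvgD => //; apply: cvgM; last exact: cvg_cst.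
    rewrite expr2; under eq_fun do rewrite expr2.
    have drJ : (fun m => d m n J) @ \oo --> r n J.
      by apply: cvgD; [exact: cvg_cst | exact: wC].
    exact: cvgM.
  apply: (cvgr_to_le lim); exists N => // m /= Nm.
  apply: le_trans (weighted_partial_le J (Hd m n)) _.
  exact: dsq (HN _ _ Nm Nn).
(* Any positive tolerance would do: one summable remainder [r N0] places [l] in the space. *)
have [N0 /(_ N0 (leqnn N0))[Hr _]] := tail 1 ltr01.
have Hl : weighted_summable lambda l.
  have -> : l = (fun j => 1 * w N0 j + r N0 j).
    by apply/funext => j; rewrite /r; ring.
  exact: weighted_summable_linear.
have HSl : H (series_fun phi l) by rewrite HE; exists l.
exists (series_fun phi l) => //.
apply/cvgr0Pnorm_le => e e0; have [N HN] := tail e e0.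
exists N => // n /= Nn; have [_] := HN n Nn.
rewrite ger0_norm ?ip_norm_ge0// (ip_norm_subC HI)//.
rewrite series_fun_linear//; have [_ <-] := wP n.
rewrite scaleN1r addrC -(sqr_ip_norm HI); last exact: (ips_sub HI).
by rewrite ler_sqr ?nnegrE ?ip_norm_ge0 ?(ltW e0).
Qed.

Lemma weighted_rkhs : is_rkhs K H ip.
Proof.
have HI := weighted_ips; have HK := weighted_kernel.
have Hcomb a : H (kernel_comb K a).
  by have [] := ip_kernel_comb HI a HK (ips_zero HI).
split=> //.
- move=> a b; have [_ ->] := ip_kernel_comb HI a HK (Hcomb b).
  apply: eq_bigr => p _; rewrite (ips_ip_sym HI)//.
  rewrite -weighted_reproducing// /kernel_comb mulr_sumr.
  (* Symmetry of [K] is read off from that of [ip] through the reproducing formula. *)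
  apply: eq_bigr => q _; rewrite mulrA (weighted_reproducing _ (HK _)).
  by rewrite (ips_ip_sym HI)// -weighted_reproducing.
- move=> f e Hf e0.
  pose M := [set kernel_comb K a | a in setT].
  have MH m : M m -> H m by move=> [a _ <-].
  have M0 : M 0 by exists [::] => //; apply/funext => t; rewrite /kernel_comb big_nil.
  have Mlin c g h : M g -> M h -> M (c *: g + h).
    move=> [a _ <-] [b _ <-]; exists ([seq (c * p.1, p.2) | p <- a] ++ b) => //.
    apply/funext => t; rewrite /kernel_comb big_cat big_map/=.
    by under eq_bigr do rewrite -mulrA; rewrite -mulr_sumr.
  have Mperp g : H g -> (forall m, M m -> ip g m = 0) -> g = 0.
    move=> Hg gM; apply/funext => t; rewrite weighted_reproducing// gM//.
    by exists [:: (1, t)] => //; exact: kernel_comb1.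
  have [_ [a _ <-] ae] :=
    dense_of_orthogonal HI weighted_complete MH M0 Mlin Mperp Hf e0.
  by exists a.
- exact: weighted_complete.
- by move=> f t; exact: weighted_reproducing.
Qed.

End Weighted.

(** * Existence of the inner product and the conclusion *)

Lemma weighted_ip_exists :
  (forall w : nat -> R, weighted_summable lambda w ->
    (forall t : T, series_fun phi w t = 0) -> forall j : nat, w j = 0) ->
  exists ip : (T -> R) -> (T -> R) -> R, forall v w : nat -> R,
    weighted_summable lambda v -> weighted_summable lambda w ->
    series (fun j => v j * w j / lambda j) @ \oo -->
      ip (series_fun phi v) (series_fun phi w).
Proof.
move=> phi_indep.
(* Chooses a coefficient sequence for [f]. The default 0 is taken only outside the candidate space,
   where [ip] is unconstrained. *)
pose coef f := xget (fun=> 0)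
  [set w | weighted_summable lambda w /\ series_fun phi w = f].
have coefE w : weighted_summable lambda w -> coef (series_fun phi w) = w.
  move=> Hw; have [Hc cE] : [set w' | weighted_summable lambda w' /\
      series_fun phi w' = series_fun phi w] (coef (series_fun phi w)).
    by apply: xgetPex; exists w.
  (* The difference of two coefficient sequences of one function represents 0, so independence makes
     it vanish. *)
  apply/funext => j; apply/eqP; rewrite -subr_eq0 addrC -mulN1r; apply/eqP.
  move: j; apply: (phi_indep (fun j => - 1 * w j + coef (series_fun phi w) j)).
    exact: weighted_summable_linear.
  by move=> t; rewrite series_fun_linear// cE scaleN1r addNr.
exists (fun f g => limn (series (fun j => coef f j * coef g j / lambda j))).
by move=> v w Hv Hw; rewrite !coefE//; exact: weighted_prod_cvg.
Qed.

End SeriesExpansion.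

Theorem theorem4p1 (R : realType) (d : measure_display)
    (Omega : measurableType d) (P : probability Omega R) (T : Type)
    (W : T -> {RV P >-> R}) (K : T -> T -> R)
    (lambda : nat -> R) (phi : nat -> T -> R)
    (W_gauss : gaussian_process W)
    (W_mean0 : forall t : T, ('E_P[W t] = 0)%E)
    (W_cov : forall s t : T, ('E_P[fun omega => (W s omega * W t omega)%R] = (K s t)%:E)%E)
    (lambda_gt0 : forall j : nat, 0 < lambda j)
    (K_series : forall s t : T,
      series (fun j => lambda j * phi j s * phi j t) @ \oo --> K s t)
    (phi_indep : forall w : nat -> R, weighted_summable lambda w ->
      (forall t : T, series_fun phi w t = 0) -> forall j : nat, w j = 0) :
  forall (H : set (T -> R)) (ip : (T -> R) -> (T -> R) -> R),
    is_rkhs K H ip <->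
    (H = [set f | exists2 w : nat -> R,
            weighted_summable lambda w & f = series_fun phi w] /\
     forall v w : nat -> R,
       weighted_summable lambda v -> weighted_summable lambda w ->
       series (fun j => v j * w j / lambda j) @ \oo -->
         ip (series_fun phi v) (series_fun phi w)).
Proof.
move=> H ip; split=> [HK|[HE ipE]]; last exact: weighted_rkhs.
have [ip0 ip0E] := weighted_ip_exists lambda_gt0 K_series phi_indep.
have HK0 := weighted_rkhs lambda_gt0 K_series erefl ip0E.
(* The two inner products agree only on [H], so [HE] is needed to place the series functions
   there. *)
have [HE ipE] := rkhs_unique HK HK0.
by split=> // v w Hv Hw; rewrite ipE ?HE; [exact: ip0E | exists v | exists w].
Qed.
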